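(* Let $\omega:[0,1]\to[0,\infty)$ be a weighting function with $\int_0^1\omega(c)\,\mathrm{d}c=1$, and let $(P_j)_{j\ge 0}$ be a family of polynomials, $P_j$ of degree $j$, orthonormal with respect to $\omega$, i.e. $\int_0^1\omega(c)P_i(c)P_j(c)\,\mathrm{d}c=\delta_{ij}$ for all $i,j\ge0$, and satisfying, for suitable real coefficients $a_j,b_j$ ($j\ge1$) and $d_j$ ($j\ge 2$), the 3-term recurrence $$P_0(c)\equiv 1,\qquad P_1(c)=(a_1c-b_1)P_0(c),\qquad P_j(c)=(a_jc-b_j)P_{j-1}(c)-d_jP_{j-2}(c),\quad j\ge2,\qquad c\in[0,1].$$ Let $\alpha>0$. Then, for all $c\in[0,1]$, the fractional integrals of the polynomials $P_j$ are given by $$I^\alpha P_j(c)=\frac{\Psi^\alpha P_j(c)}{\Gamma(\alpha)},\qquad j\ge0,$$ where $$\Psi^\alpha P_0(c)=\frac{c^\alpha}{\alpha},$$ $$\Psi^\alpha P_1(c)=(a_1c-b_1)\Psi^\alpha P_0(c)-a_1\Psi^{\alpha+1}P_0(c),$$ $$\Psi^\alpha P_j(c)=(a_jc-b_j)\Psi^\alpha P_{j-1}(c)-a_j\Psi^{\alpha+1}P_{j-1}(c)-d_j\Psi^\alpha P_{j-2}(c),\qquad j\ge2.$$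
   Context: For $\alpha>0$ and a function $g$, the Riemann-Liouville fractional integral of order $\alpha$ and the function $\Psi^\alpha g$ are defined, for $t\ge0$, by $$I^\alpha g(t)=\frac{1}{\Gamma(\alpha)}\int_0^t(t-x)^{\alpha-1}g(x)\,\mathrm{d}x,\qquad \Psi^\alpha g(t)=\int_0^t(t-x)^{\alpha-1}g(x)\,\mathrm{d}x,$$ where $\Gamma$ is Euler's Gamma function. $\Psi^{\alpha+1}$ denotes the same operator with $\alpha$ replaced by $\alpha+1$. *)

(* Defs.v *)
From HB Require Import structures.
From mathcomp Require Import all_boot all_order all_algebra.
From mathcomp Require Import all_classical all_reals all_analysis.

Set Implicit Arguments.
Unset Strict Implicit.
Unset Printing Implicit Defensive.

Import Order.TTheory GRing.Theory Num.Theory.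
Import numFieldNormedType.Exports.

Local Open Scope classical_set_scope.
Local Open Scope ring_scope.

Section FractionalIntegral.
Context {R : realType}.
Local Notation mu := (@lebesgue_measure R).

(* Euler's integral; it is the Gamma function only for a > 0. *)
Definition eulerGamma (a : R) : R :=
  \int[mu]_(x in `]0, +oo[) (x `^ (a - 1) * expR (- x)).

(* For a < 1 the kernel is singular at x = t, where the convention for
   0 `^ (a - 1) gives it the value 0; a single point has measure zero, so this
   does not affect the integral. *)
Definition fracPsi (a : R) (g : R -> R) (t : R) : R :=
  \int[mu]_(x in `[0, t]) ((t - x) `^ (a - 1) * g x).

Definition fracInt (a : R) (g : R -> R) (t : R) : R :=
  (eulerGamma a)^-1 * \int[mu]_(x in `[0, t]) ((t - x) `^ (a - 1) * g x).

End FractionalIntegral.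

(* Main.v *)
Require Import Defs.
From HB Require Import structures.
From mathcomp Require Import all_boot all_order all_algebra.
From mathcomp Require Import ring.
From mathcomp Require Import all_classical all_reals all_analysis.
From mathcomp Require Import measurable_realfun.

Set Implicit Arguments.
Unset Strict Implicit.
Unset Printing Implicit Defensive.

Import Order.TTheory GRing.Theory Num.Theory.
Import numFieldNormedType.Exports.

Local Open Scope classical_set_scope.
Local Open Scope ring_scope.

(** Everything rests on one pointwise identity. Multiplying the integrand by the
    affine factor A x - B of the recurrence, one writes x = t - (t - x); the
    first term comes out of the integral, and in the second one the extra factor
    t - x raises the exponent of the kernel by one:
      Psi^a (x g) (t) = t Psi^a g (t) - Psi^(a+1) g (t)   (fracPsi_mulX).
    By linearity of Psi^a, the three-term recurrence for P_j then becomes the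
    stated recurrence for Psi^a P_j.

    What needs care is linearity itself: the Lebesgue integral is additive only
    on integrable functions, and for a < 1 the kernel (t - x)^(a-1) is unbounded
    near x = t. Its integrability, together with the value t^a / a of its
    integral, which is Psi^a P_0, is integral_fracKernel: it follows from the
    primitive - (t - x)^a / a, continuous up to x = t, by a fundamental theorem
    of calculus for nonnegative integrands that may be singular at the right
    endpoint (ge0_continuous_FTC2_bndo). A continuous factor on the compact
    interval [0, t] is bounded, hence preserves integrability
    (integrable_fracKernelM). *)

Lemma itv_bndo_bigcup_bndc (R : realType) (a b : R) : a < b ->
  `[a, b[%classic = \bigcup_n `[a, b - (b - a) / n.+2%:R]%classic.
Proof.
move=> ab; apply/seteqP; split => x /=; rewrite in_itv/=; last first.
  case=> n _ /=; rewrite in_itv/= => /andP[-> xb] /=.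
  by rewrite (le_lt_trans xb)// ltrBlDr ltrDl divr_gt0 ?subr_gt0.
case/andP => ax xb.
have ba_gt0 : 0 < b - a by rewrite subr_gt0.
have e_gt0 : 0 < (b - x) / (b - a) by rewrite divr_gt0// subr_gt0.
have [n _ /(_ n (leqnn n)) /= hn] := near_infty_natSinv_lt (PosNum e_gt0).
exists n => //=; rewrite in_itv/= ax/= lerBrDr -lerBrDl mulrC -ler_pdivlMr//.
by apply: le_trans (ltW hn); rewrite lef_pV2 ?posrE// ler_nat.
Qed.

(** Where f may blow up at b, the integral is approached from the left: on each
    [a, u n] with u n < b it is F (u n) - F a by the usual theorem, and since f
    is nonnegative these values increase to the integral over [a, b[ by monotone
    convergence. In particular f is integrable on [a, b[ as soon as F has a
    finite left limit at b. *)
Lemma ge0_continuous_FTC2_bndo (R : realType) (f F : R -> R) (a b l : R) :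
  a < b ->
  {in `[a, b[, forall x, 0 <= f x} ->
  {in `[a, b[, continuous f} ->
  {in `[a, b[, forall x : R, is_derive x 1 F (f x)} ->
  F x @[x --> b^'-] --> l ->
  (\int[lebesgue_measure]_(x in `[a, b[) (f x)%:E = (l - F a)%:E)%E.
Proof.
move=> ab f0 cf dF Fl.
(* n.+2 rather than n.+1, so that already u 0 > a *)
pose u n : R := b - (b - a) / n.+2%:R.
have au n : a < u n.
  by rewrite /u ltrBrDr -ltrBrDl ltr_pdivrMr// ltr_pMr ?subr_gt0// ltr1n.
have ub n : u n < b by rewrite /u ltrBlDr ltrDl divr_gt0 ?subr_gt0.
have sub n x : x \in `[a, u n] -> x \in `[a, b[.
  by rewrite !in_itv/= => /andP[-> /=] /le_lt_trans; exact.
have cfu n : {within `[a, u n], continuous f}.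
  by apply: continuous_in_subspaceT => x; rewrite inE => /sub; exact: cf.
have cFu x : x \in `[a, b[ -> {for x, continuous F}.
  move=> /dF dFx; apply: differentiable_continuous; apply/derivable1_diffP.
  by apply: ex_derive.
have intu n : (\int[lebesgue_measure]_(x in `[a, u n]) (f x)%:E
    = (F (u n))%:E - (F a)%:E)%E.
  apply: continuous_FTC2 => //.
  - split.
    + move=> x /subset_itv_oo_cc /sub /dF dFx; exact: ex_derive.
    + by apply: cvg_at_right_filter; apply: cFu; rewrite in_itv/= lexx.
    + by apply: cvg_at_left_filter; apply: cFu; rewrite in_itv/= ub ltW.
  - move=> x /subset_itv_oo_cc /sub /dF dFx; rewrite derive1E.
    exact: derive_val.
have ucvg : u n @[n --> \oo] --> b.
  rewrite -[X in _ --> X]subr0; apply: cvgB; first exact: cvg_cst.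
  rewrite -[X in _ --> X](mulr0 (b - a)); apply: cvgM; first exact: cvg_cst.
  have := @cvg_harmonic R; rewrite -(cvg_shiftn 1)/=.
  by under eq_fun do rewrite addn1.
have intE : EFin \o (fun n => F (u n) - F a) =
    fun n => (\int[lebesgue_measure]_(x in `[a, u n]) (f x)%:E)%E.
  by apply/funext => n; rewrite intu.
have intcvg : (F (u n) - F a)%:E @[n --> \oo] --> (l - F a)%:E.
  apply: cvg_EFin; first exact: nearW.
  apply: cvgB; last exact: cvg_cst.
  by apply: (cvg_at_leftP _ _ _).1 Fl _ _.
suff : EFin \o (fun n => F (u n) - F a) @ \oo -->
    (\int[lebesgue_measure]_(x in `[a, b[) (f x)%:E)%E.
  by move=> /cvg_unique; apply.
rewrite intE itv_bndo_bigcup_bndc//.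
apply: (@ge0_nondecreasing_set_cvg_integral _ (measurableTypeR R)) => //.
- move=> m n mn; rewrite subsetEset; apply: subset_itvl; rewrite bnd_simp.
  rewrite /u lerD2l lerN2 ler_pM2l ?subr_gt0// lef_pV2 ?posrE// ler_nat.
  by rewrite !ltnS.
- move=> n; apply/measurable_EFinP.
  by apply: subspace_continuous_measurable_fun.
- by move=> n x /sub/f0; rewrite lee_fin.
Qed.

Section FracPsi.
Context {R : realType}.
Local Notation mu := (@lebesgue_measure R).
Implicit Types (a t A B : R) (f g h : R -> R).

(** The integral is kept in the extended reals because its finiteness is the
    integrability of the kernel, which the real-valued integral cannot
    express. *)
Lemma integral_fracKernel a t : 0 < a -> 0 <= t ->
  (\int[mu]_(x in `[0%R, t]) ((t - x) `^ (a - 1))%:E = (t `^ a / a)%:E)%E.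
Proof.
move=> a_gt0; rewrite le_eqVlt => /predU1P[<-|t_gt0].
  by rewrite set_itv1 integral_set1 powR0 ?mul0r ?gt_eqF.
pose F (y : R) : R := - a^-1 * (t - y) `^ a.
have dF (x : R) : x \in `[0, t[ -> is_derive x 1 F ((t - x) `^ (a - 1)).
  rewrite in_itv/= => /andP[_ xt].
  have tx : 0 < t - x by rewrite subr_gt0.
  have d1 : is_derive x (1 : R) (fun y : R => t - y) (-1).
    by apply: is_derive_eq; rewrite add0r mul1r.
  have d2 := is_deriveZ (- a^-1) (@is_derive1_comp R (@powR R ^~ a) (fun y => t - y) _ _ _
    (is_derive1_powR a tx) d1).
  apply: is_derive_eq d2 _.
  by rewrite /GRing.scale/= mulrN1 mulrNN mulrA mulVf ?mul1r// gt_eqF.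
have cf : {in `[0, t[, continuous (fun x => (t - x) `^ (a - 1))}.
  move=> x; rewrite in_itv/= => /andP[_ xt].
  have tx : 0 < t - x by rewrite subr_gt0.
  apply: (@continuous_comp R R R (fun y => t - y) (@powR R ^~ (a - 1))).
    by apply: cvgB; [exact: cvg_cst|exact: cvg_id].
  apply: differentiable_continuous; apply/derivable1_diffP.
  by apply: derivable_powR; rewrite in_itv/= tx.
(* the singular endpoint x = t is a null set *)
rewrite -integral_itv_bndo_bndc; last first.
  apply/measurable_EFinP/measurable_funTS.
  apply: (measurableT_comp (measurable_powR _)).
  exact: measurable_funB.
rewrite (@ge0_continuous_FTC2_bndo _ _ F _ _ 0)//.
- by rewrite /F subr0 sub0r mulNr opprK mulrC.
- by move=> x _; exact: powR_ge0.
rewrite -(mulr0 (- a^-1)); apply: cvgMr.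
apply: (@decreasing_cvg_at_left_comp _ (fun y => t - y) (@powR R ^~ a) -oo%O) => //.
- by move=> x y _ _ xy; rewrite ltrD2l ltrN2.
- apply: cvg_at_left_filter.
  by apply: cvgB; [exact: cvg_cst|exact: cvg_id].
- by rewrite subrr; exact: powR_cvg0.
Qed.

Lemma integrable_fracKernelM a t g : 0 < a -> 0 <= t ->
  {within `[0, t], continuous g} ->
  mu.-integrable `[0, t] (EFin \o (fun x => (t - x) `^ (a - 1) * g x)).
Proof.
move=> a_gt0 t_ge0 cg.
have mk : measurable_fun `[0, t] (fun x : R => (t - x) `^ (a - 1)).
  apply: measurable_funTS; apply: (measurableT_comp (measurable_powR _)).
  exact: measurable_funB.
have ik : mu.-integrable `[0, t] (EFin \o (fun x => (t - x) `^ (a - 1))).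
  apply/integrableP; split; first exact/measurable_EFinP.
  under eq_integral do rewrite /= ger0_norm ?powR_ge0//.
  by rewrite integral_fracKernel// ltry.
have mg : measurable_fun `[0, t] g by exact: subspace_continuous_measurable_fun.
have bg : [bounded g x | x in `[0, t]].
  have := compact_bounded (continuous_compact cg (@segment_compact _ _ _)).
  by case=> M [Mr HM]; exists M; split=> // y My x xt; apply: HM => //; exists x.
exact: integrableMl ik mg bg.
Qed.

Lemma eq_fracPsi a t f g : {in `[0, t], f =1 g} -> fracPsi a f t = fracPsi a g t.
Proof.
by move=> fg; apply: eq_Rintegral => x; rewrite inE/= => xt; rewrite fg.
Qed.

Lemma fracPsiZ a t A g : 0 < a -> 0 <= t -> {within `[0, t], continuous g} ->
  fracPsi a (fun x => A * g x) t = A * fracPsi a g t.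
Proof.
move=> a_gt0 t_ge0 cg; rewrite -RintegralZl//; last exact: integrable_fracKernelM.
by apply: eq_Rintegral => x _; rewrite mulrCA.
Qed.

Lemma fracPsiB a t f g : 0 < a -> 0 <= t ->
  {within `[0, t], continuous f} -> {within `[0, t], continuous g} ->
  fracPsi a (fun x => f x - g x) t = fracPsi a f t - fracPsi a g t.
Proof.
move=> a_gt0 t_ge0 cf cg; rewrite -RintegralB//; [|exact: integrable_fracKernelM..].
by apply: eq_Rintegral => x _; rewrite mulrBr.
Qed.

(** Write x = t - (t - x): the factor t - x is absorbed by the kernel, whose
    exponent goes from a - 1 to a. *)
Lemma fracPsi_mulX a t g : 0 < a -> 0 <= t -> {within `[0, t], continuous g} ->
  fracPsi a (fun x => x * g x) t = t * fracPsi a g t - fracPsi (a + 1) g t.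
Proof.
move=> a_gt0 t_ge0 cg.
rewrite -RintegralZl//; last exact: integrable_fracKernelM.
rewrite -RintegralB//; last 2 first.
- exact: (integrableZl _ t (integrable_fracKernelM a_gt0 t_ge0 cg)).
- by apply: integrable_fracKernelM => //; rewrite addr_gt0.
apply: eq_Rintegral => x; rewrite inE/= in_itv/= => /andP[_ xt].
(* at x = t the identity 0 * 0 `^ (a - 1) = 0 `^ a also holds, because 0 < a *)
by rewrite addrK -(@mulr_powRB1 _ (t - x) a) ?subr_ge0//; ring.
Qed.

Lemma fracPsi_affineM a t A B g : 0 < a -> 0 <= t ->
  {within `[0, t], continuous g} ->
  fracPsi a (fun x => (A * x - B) * g x) t
    = (A * t - B) * fracPsi a g t - A * fracPsi (a + 1) g t.
Proof.
move=> a_gt0 t_ge0 cg.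
have cZ B' h : {within `[0, t], continuous h} ->
    {within `[0, t], continuous (fun x => B' * h x)}.
  by move=> ch x; apply: cvgMr; exact: ch.
have cX : {within `[0, t], continuous (fun x => x * g x)}.
  move=> x; apply: cvgM; last exact: cg.
  by apply: continuous_subspaceT => y; exact: cvg_id.
rewrite (@eq_fracPsi _ _ _ (fun x => A * (x * g x) - B * g x)); last first.
  by move=> x _; ring.
rewrite fracPsiB//; [|exact: cZ..].
by rewrite !fracPsiZ// fracPsi_mulX//; ring.
Qed.

End FracPsi.

Theorem theorem1 (R : realType) (w : R -> R)
  (w_ge0 : forall c : R, 0 <= c <= 1 -> 0 <= w c)
  (w_int : (@lebesgue_measure R).-integrable `[0, 1] (EFin \o w))
  (w_mass : \int[@lebesgue_measure R]_(c in `[0, 1]) w c = 1)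
  (P : nat -> {poly R})
  (P_deg : forall j : nat, size (P j) = j.+1)
  (P_orth : forall i j : nat,
    \int[@lebesgue_measure R]_(c in `[0, 1]) (w c * (P i).[c] * (P j).[c])
      = (i == j)%:R)
  (a b d : nat -> R)
  (P_0 : forall c : R, 0 <= c <= 1 -> (P 0%N).[c] = 1)
  (P_1 : forall c : R, 0 <= c <= 1 ->
    (P 1%N).[c] = (a 1%N * c - b 1%N) * (P 0%N).[c])
  (P_rec : forall j : nat, (2 <= j)%N -> forall c : R, 0 <= c <= 1 ->
    (P j).[c] = (a j * c - b j) * (P (j - 1)%N).[c] - d j * (P (j - 2)%N).[c])
  (alpha : R) (alpha_gt0 : 0 < alpha) (c : R) (c_01 : 0 <= c <= 1) :
  (forall j : nat,
    fracInt alpha (horner (P j)) c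
      = fracPsi alpha (horner (P j)) c / eulerGamma alpha) /\
  fracPsi alpha (horner (P 0%N)) c = c `^ alpha / alpha /\
  fracPsi alpha (horner (P 1%N)) c
    = (a 1%N * c - b 1%N) * fracPsi alpha (horner (P 0%N)) c
      - a 1%N * fracPsi (alpha + 1) (horner (P 0%N)) c /\
  (forall j : nat, (2 <= j)%N ->
    fracPsi alpha (horner (P j)) c
      = (a j * c - b j) * fracPsi alpha (horner (P (j - 1)%N)) c
        - a j * fracPsi (alpha + 1) (horner (P (j - 1)%N)) c
        - d j * fracPsi alpha (horner (P (j - 2)%N)) c).
Proof.
have /andP[c_ge0 c_le1] := c_01.
have sub01 x : x \in `[0, c] -> 0 <= x <= 1.
  by rewrite in_itv/= => /andP[-> /le_trans->].
have cP j : {within `[0, c], continuous (horner (P j))}.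
  exact/continuous_subspaceT/continuous_horner.
have cA A B j : {within `[0, c], continuous (fun x => (A * x - B) * (P j).[x])}.
  have -> : (fun x => (A * x - B) * (P j).[x]) =
      horner ((A%:P * 'X - B%:P) * P j).
    by apply/funext => x; rewrite !hornerE.
  exact/continuous_subspaceT/continuous_horner.
have cZ A j : {within `[0, c], continuous (fun x => A * (P j).[x])}.
  by move=> x; apply: cvgMr; exact: cP.
split; [|split; [|split]].
- by move=> j; rewrite /fracInt mulrC.
- rewrite (@eq_fracPsi _ _ _ _ (fun=> 1)); last by move=> x /sub01 /P_0.
  rewrite /fracPsi; under eq_Rintegral do rewrite mulr1.
  by rewrite /Rintegral integral_fracKernel.
- rewrite -fracPsi_affineM//.
  by apply: eq_fracPsi => x /sub01 /P_1.
- move=> j j2.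
  rewrite -fracPsi_affineM// -fracPsiZ// -fracPsiB//.
  by apply: eq_fracPsi => x /sub01 /(P_rec j j2).
Qed.
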